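(* Let $r$ be a power of $2$. For each odd integer $n>0$ let $A_n\in t\,\mathbb{Z}/2[t^2]$, and suppose that for all odd $n>0$ \[ A_{n+8r}=t^{8r}A_n+t^{2r}A_{n+2r}. \] If for every odd $n<8r^2$, $A_n$ equals $t^n$ plus a sum of monomials preceding $t^n$, then this holds for every odd $n>0$.
   Context: $\mathbb{N}=\{0,1,2,\dots\}$. Let $g:\mathbb{N}\to\mathbb{N}$ be defined by $g(0)=0$, $g(2n)=4g(n)$, $g(2n+1)=g(2n)+1$. For $a,b\in\mathbb{N}$, $[a,b]$ denotes the monomial $t^{1+2g(a)+4g(b)}\in\mathbb{Z}/2[t]$; $(a,b)\mapsto[a,b]$ is a bijection from $\mathbb{N}\times\mathbb{N}$ onto the monomials $t^k$, $k$ odd and positive. Say $[c,d]$ precedes (is earlier than) $[a,b]$ if $c+d<a+b$, or $c+d=a+b$ and $d<b$. ''A sum of monomials'' with some property means a finite sum (possibly empty) of distinct monomials with that property. *)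

(* Defs.v *)
From mathcomp Require Import all_boot all_order all_algebra.
From mathcomp Require Import zify.

Set Implicit Arguments.
Unset Strict Implicit.
Unset Printing Implicit Defensive.

Import GRing.Theory.
Local Open Scope ring_scope.

(* [fuel] only has to be at least the number of binary digits of [n];
   [g0], [g_double] and [g_doubleS] are the defining equations of [g]. *)
Fixpoint g_rec (fuel n : nat) : nat :=
  if fuel is fuel'.+1 then (4 * g_rec fuel' n./2 + odd n)%N else 0%N.

Definition g (n : nat) : nat := g_rec n n.

Lemma g_rec_fuel f1 f2 n : (n <= f1)%N -> (n <= f2)%N -> g_rec f1 n = g_rec f2 n.
Proof.
have z f : g_rec f 0 = 0%N by elim: f => //= f ->.
elim: f1 f2 n => [|f1 IH] [|f2] n // h1 h2.
- have -> : n = 0%N by lia.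
  by rewrite z.
- have -> : n = 0%N by lia.
  by rewrite z.
- by rewrite /= (IH f2) //; lia.
Qed.

Lemma g0 : g 0 = 0%N. Proof. by []. Qed.

Lemma g_half n : g n = (4 * g n./2 + odd n)%N.
Proof.
case: n => [|n] //.
rewrite {1}/g [LHS]/= (@g_rec_fuel n (uphalf n)) //; lia.
Qed.

Lemma g_double n : g (2 * n) = (4 * g n)%N.
Proof. by rewrite g_half mul2n doubleK odd_double addn0. Qed.

Lemma g_doubleS n : g (2 * n + 1) = (g (2 * n) + 1)%N.
Proof.
rewrite g_double g_half mul2n addn1 /= odd_double /=.
by rewrite uphalf_double.
Qed.

Definition mon (a b : nat) : {poly 'F_2} := 'X^(1 + 2 * g a + 4 * g b).

Definition precedes (m m' : {poly 'F_2}) : Prop :=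
  exists c d a b : nat,
    [/\ m = mon c d, m' = mon a b &
        (c + d < a + b)%N \/ (c + d = a + b)%N /\ (d < b)%N].

(* Every [m] for which [precedes m m'] holds is a monomial, so [s] below is a
   list of distinct monomials. *)
Definition sum_of_preceding (m' p : {poly 'F_2}) : Prop :=
  exists s : seq {poly 'F_2},
    [/\ uniq s, (forall m, m \in s -> precedes m m') & p = \sum_(m <- s) m].

(* Membership in t(Z/2)[t^2]. *)
Definition in_tZ2t2 (p : {poly 'F_2}) : Prop :=
  exists q : {poly 'F_2}, p = 'X * (q \Po 'X^2).

Definition leads_with (n : nat) (p : {poly 'F_2}) : Prop :=
  exists S : {poly 'F_2}, sum_of_preceding 'X^n S /\ p = 'X^n + S.

(* Main.v *)
Require Import Defs.
From mathcomp Require Import all_boot all_order all_algebra.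
From mathcomp Require Import zify.

(** Squaring the recurrence, in the sense of applying it to its own right-hand
    side, replaces [r] by [2r]; so it holds for every power of two [R >= r].
    Write an odd exponent as [2k + 1], with [[a, b]] having
    [k = g a + 2 g b]: the binary digits of [a] and [b] interleave to those of
    [k].  Adding a power of two [2^p] to [k] without a carry adds the pair of
    [2^p] to the pair of [k], and a carry can only make the result earlier.
    For [n >= 8r] choose [R] so that [4R] is the top binary digit of
    [(n - 1) / 2], and let [n = m + 8R].  As [m + 8R] involves no carry,
    [t^(8R)] maps monomials preceding [t^m] to monomials preceding [t^n], and
    since the pair of [4R] is twice that of [R], while the pair of [2R] lies
    strictly before it, [t^(2R) A_(m+2R)] contributes only monomials preceding
    [t^n].  Strong induction on [n] concludes. *)

Set Implicit Arguments.
Unset Strict Implicit.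
Unset Printing Implicit Defensive.

Import GRing.Theory.
Local Open Scope ring_scope.

(** * Interleaving of binary digits *)

Fixpoint even_bits_rec (fuel k : nat) : nat :=
  if fuel is fuel'.+1 then (2 * even_bits_rec fuel' (k %/ 4) + odd k)%N else 0%N.

Definition even_bits (k : nat) : nat := even_bits_rec k k.
Definition odd_bits (k : nat) : nat := even_bits k./2.

Lemma even_bits_rec_fuel f1 f2 k :
  (k <= f1)%N -> (k <= f2)%N -> even_bits_rec f1 k = even_bits_rec f2 k.
Proof.
have z f : even_bits_rec f 0 = 0%N by elim: f => //= f; rewrite div0n => ->.
elim: f1 f2 k => [|f1 IH] [|f2] k // h1 h2.
- by have -> : k = 0%N; [lia | rewrite z].
- by have -> : k = 0%N; [lia | rewrite z].
- by rewrite /= (IH f2) //; lia.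
Qed.

Lemma even_bits4 k : even_bits k = (2 * even_bits (k %/ 4) + odd k)%N.
Proof.
case: k => [|k] //; rewrite {1}/even_bits [LHS]/=.
by rewrite (@even_bits_rec_fuel k (k.+1 %/ 4)) //; lia.
Qed.

Lemma odd_bits4 k : odd_bits k = (2 * odd_bits (k %/ 4) + odd k./2)%N.
Proof.
rewrite /odd_bits even_bits4; have -> // : (k./2 %/ 4 = (k %/ 4)./2)%N by lia.
Qed.

Lemma even_bits_gg a b : even_bits (g a + 2 * g b) = a.
Proof.
(* Division by 4 halves both [a] and [b]; for [a = 0] only [b] decreases, hence the inner
   induction. *)
elim/ltn_ind: a b => -[|a] IH b.
  elim/ltn_ind: b => -[|b] IHb //.
  rewrite even_bits4 [g b.+1]g_half.
  have -> : ((g 0 + 2 * (4 * g b.+1./2 + odd b.+1)) %/ 4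
    = g 0 + 2 * g b.+1./2)%N by rewrite g0; lia.
  by rewrite IHb ?g0; lia.
rewrite even_bits4 [g a.+1]g_half [g b]g_half.
have -> : ((4 * g a.+1./2 + odd a.+1 + 2 * (4 * g b./2 + odd b)) %/ 4
  = g a.+1./2 + 2 * g b./2)%N by lia.
by rewrite IH; lia.
Qed.

Lemma odd_bits_gg a b : odd_bits (g a + 2 * g b) = b.
Proof.
rewrite /odd_bits [g a]g_half.
(* Halving shifts the digits by one place, so [b] moves to the even positions. *)
have -> : ((4 * g a./2 + odd a + 2 * g b)./2 = g b + 2 * g a./2)%N by lia.
exact: even_bits_gg.
Qed.

Lemma gg_bits k : (g (even_bits k) + 2 * g (odd_bits k))%N = k.
Proof.
elim/ltn_ind: k => -[|k] IH //.
have gb x (c : bool) : g (2 * x + c) = (4 * g x + c)%N.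
  by case: c; rewrite ?addn0 ?g_doubleS g_double.
rewrite even_bits4 odd_bits4 !gb.
by have := IH (k.+1 %/ 4)%N; lia.
Qed.

(** * The order on monomials, read on digit pairs *)

Definition lex_lt (x y : nat * nat) : Prop :=
  (x.1 + x.2 < y.1 + y.2)%N \/ (x.1 + x.2 = y.1 + y.2)%N /\ (x.2 < y.2)%N.

Lemma precedesP k l :
  precedes 'X^(2 * k + 1) 'X^(2 * l + 1) <->
  lex_lt (even_bits k, odd_bits k) (even_bits l, odd_bits l).
Proof.
have monE j : 'X^(2 * j + 1) = mon (even_bits j) (odd_bits j).
  by rewrite /mon -{1}(gg_bits j); congr ('X^ _); lia.
have monI j a b : 'X^(2 * j + 1) = mon a b -> j = (g a + 2 * g b)%N.
  by move/(congr1 (fun p : {poly 'F_2} => size p)); rewrite /mon !size_polyXn; lia.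
split=> [[c [d [a [b [/monI-> /monI-> h]]]]]|h].
  by rewrite !even_bits_gg !odd_bits_gg.
by exists (even_bits k), (odd_bits k), (even_bits l), (odd_bits l); split.
Qed.

Lemma precedes_odd i n : precedes 'X^i 'X^n -> odd i.
Proof.
case=> c [d [a [b [/(congr1 (fun p : {poly 'F_2} => size p)) + _ _]]]].
by rewrite /mon !size_polyXn; lia.
Qed.

(** * Adding a power of two *)

Lemma bits_add_pow2_nocarry p k : (k < 2 ^ p)%N ->
  even_bits (k + 2 ^ p) = (even_bits k + even_bits (2 ^ p))%N /\
  odd_bits (k + 2 ^ p) = (odd_bits k + odd_bits (2 ^ p))%N.
Proof.
have E : forall p k, (k < 2 ^ p)%N ->
    even_bits (k + 2 ^ p) = (even_bits k + even_bits (2 ^ p))%N.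
  move=> {p k}; elim/ltn_ind=> -[|[|p]] IH k.
  - by case: k.
  - by case: k => [|[|k]].
  rewrite !expnS => kp.
  rewrite [LHS]even_bits4 [even_bits k]even_bits4.
  rewrite [even_bits (2 * _)]even_bits4.
  have -> : ((k + 2 * (2 * 2 ^ p)) %/ 4 = k %/ 4 + 2 ^ p)%N by lia.
  have -> : (2 * (2 * 2 ^ p) %/ 4 = 2 ^ p)%N by lia.
  by rewrite IH; lia.
move=> kp; split; first exact: E.
rewrite /odd_bits; case: p kp => [|p]; first by case: k.
rewrite expnS => kp.
have -> : ((k + 2 * 2 ^ p)./2 = k./2 + 2 ^ p)%N by lia.
have -> : ((2 * 2 ^ p)./2 = 2 ^ p)%N by lia.
by rewrite E //; lia.
Qed.

(** A carry trades twice the pair of 2^i for the pair of 2^(i+1): (2^(j+1), 0) becomes (0, 2^j) if i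
    = 2j, with smaller sum, and (0, 2^(j+1)) becomes (2^(j+1), 0) if i = 2j+1, with equal sum and
    smaller second entry. *)
Lemma bits_add_pow2 p k :
  ~ lex_lt (even_bits k + even_bits (2 ^ p), odd_bits k + odd_bits (2 ^ p))%N
           (even_bits (k + 2 ^ p), odd_bits (k + 2 ^ p)).
Proof.
have q0 j : ~ lex_lt (even_bits j + 1, odd_bits j)%N
                     (even_bits (j + 1), odd_bits (j + 1)).
  elim/ltn_ind: j => j IH; rewrite /lex_lt /=.
  (* Only the base-4 digit 3 carries into [j %/ 4]; its digit pair (1, 1) then becomes (0, 0). *)
  have [h|h] := eqVneq (j %% 4)%N 3%N.
    have := IH (j %/ 4)%N; rewrite /lex_lt /=.
    rewrite ![even_bits j]even_bits4 ![odd_bits j]odd_bits4.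
    rewrite ![even_bits (j + 1)]even_bits4 ![odd_bits (j + 1)]odd_bits4.
    have -> : ((j + 1) %/ 4 = j %/ 4 + 1)%N by lia.
    by lia.
  rewrite ![even_bits j]even_bits4 ![odd_bits j]odd_bits4.
  rewrite ![even_bits (j + 1)]even_bits4 ![odd_bits (j + 1)]odd_bits4.
  have -> : ((j + 1) %/ 4 = j %/ 4)%N by lia.
  by lia.
elim/ltn_ind: p k => -[|[|p]] IH k; rewrite /lex_lt /=.
- by have := q0 k; rewrite /lex_lt /= expn0 addn0.
- rewrite expn1 (_ : even_bits 2 = 0%N) // (_ : odd_bits 2 = 1%N) //.
  have := q0 (k %/ 4)%N; rewrite /lex_lt /=.
  rewrite ![even_bits k]even_bits4 ![odd_bits k]odd_bits4.
  rewrite ![even_bits (k + 2)]even_bits4 ![odd_bits (k + 2)]odd_bits4.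
  have [[-> ?]|[-> ?]] : ((k + 2) %/ 4 = k %/ 4 /\ odd k./2 = false \/
      (k + 2) %/ 4 = k %/ 4 + 1 /\ odd k./2 = true)%N by lia.
    by lia.
  by lia.
- have := IH p (ltnW (ltnSn _)) (k %/ 4)%N.
  rewrite /lex_lt /= !expnS.
  rewrite ![even_bits k]even_bits4 ![odd_bits k]odd_bits4.
  rewrite ![even_bits (2 * _)]even_bits4 ![odd_bits (2 * _)]odd_bits4.
  rewrite ![even_bits (k + 2 * _)]even_bits4 ![odd_bits (k + 2 * _)]odd_bits4.
  have -> : ((k + 2 * (2 * 2 ^ p)) %/ 4 = k %/ 4 + 2 ^ p)%N by lia.
  have -> : (2 * (2 * 2 ^ p) %/ 4 = 2 ^ p)%N by lia.
  by lia.
Qed.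

Lemma bits_quadruple k :
  even_bits (4 * k) = (2 * even_bits k)%N /\ odd_bits (4 * k) = (2 * odd_bits k)%N.
Proof.
rewrite even_bits4 odd_bits4; have -> : (4 * k %/ 4 = k)%N by lia.
by lia.
Qed.

(** This is a single carry. The base cases are the two parities of [p], and quadrupling doubles both
    pairs. *)
Lemma bits_pow2S_lt p :
  lex_lt (even_bits (2 ^ p.+1), odd_bits (2 ^ p.+1))
         (2 * even_bits (2 ^ p), 2 * odd_bits (2 ^ p))%N.
Proof.
elim/ltn_ind: p => -[|[|p]] IH; [by left | by right | ].
have e q : (2 ^ q.+2 = 4 * 2 ^ q)%N by rewrite !expnS; lia.
have := IH p (ltnW (ltnSn _)); rewrite /lex_lt /= (e p.+1) (e p).
have := bits_quadruple (2 ^ p.+1); have := bits_quadruple (2 ^ p).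
by lia.
Qed.

(** * Supports of polynomials over F_2, and the recurrence *)

Lemma F2_eq1 (x : 'F_2) : x != 0 -> x = 1.
Proof. by case: x => -[|[|m]] // hm _; apply: val_inj. Qed.

(** Over F_2 a polynomial is the sum of the monomials in its support. *)
Lemma sum_of_precedingP n (p : {poly 'F_2}) :
  sum_of_preceding 'X^n p <-> forall i, p`_i != 0 -> precedes 'X^i 'X^n.
Proof.
split=> [[s [_ hs ->]] i|h].
  rewrite coef_sum => nz.
  have [m ms mi] : exists2 m : {poly 'F_2}, m \in s & m`_i != 0.
    apply/hasP; apply: contraNT nz => /hasPn h.
    by rewrite big_seq big1 // => m /h; rewrite negbK => /eqP.
  have := hs m ms => pm; case: (pm) => c [d [a [b [e _ _]]]].
  move: mi pm; rewrite e /mon coefXn.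
  by case: (eqVneq i _) => [-> //|_]; rewrite eqxx.
have injX : injective (fun i : nat => 'X^i : {poly 'F_2}).
  by move=> i j /(congr1 (fun q : {poly 'F_2} => size q)); rewrite !size_polyXn => -[].
exists [seq 'X^i | i <- [seq i <- iota 0 (size p) | p`_i != 0]]; split.
- by rewrite map_inj_uniq // filter_uniq // iota_uniq.
- by move=> m /mapP [i]; rewrite mem_filter => /andP [/h ? _] ->.
- rewrite big_map big_filter -{1}[p]coefK poly_def.
  rewrite -(big_mkord xpredT (fun i => p`_i *: 'X^i)) /index_iota subn0.
  rewrite [RHS]big_mkcond; apply: eq_bigr => i _.
  by case: eqVneq => [->|/F2_eq1->]; rewrite ?scale0r ?scale1r.
Qed.

Lemma leads_withP n (p : {poly 'F_2}) :
  leads_with n p <-> forall i, (p - 'X^n)`_i != 0 -> precedes 'X^i 'X^n.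
Proof.
rewrite -sum_of_precedingP; split=> [[S [hS ->]]|h].
  by rewrite addrAC subrr add0r.
by exists (p - 'X^n); split=> //; rewrite addrC subrK.
Qed.

(* In characteristic 2 the two cross terms of the iterated recurrence cancel. *)
Lemma recurrence_double (r : nat) (A : nat -> {poly 'F_2}) :
  (forall n, odd n ->
     A (n + 8 * r)%N = 'X^(8 * r) * A n + 'X^(2 * r) * A (n + 2 * r)%N) ->
  forall n, odd n ->
     A (n + 8 * (2 * r))%N =
       'X^(8 * (2 * r)) * A n + 'X^(2 * (2 * r)) * A (n + 2 * (2 * r))%N.
Proof.
move=> h n on.
have -> : (n + 8 * (2 * r) = (n + 8 * r) + 8 * r)%N by lia.
rewrite h; last by lia.
have -> : (n + 8 * r + 2 * r = (n + 2 * r) + 8 * r)%N by lia.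
rewrite !h //; last by lia.
have -> : (n + 2 * r + 2 * r = n + 2 * (2 * r))%N by lia.
rewrite !mulrDr !mulrA -!exprD [(8 * r + 2 * r)%N]addnC addrA.
rewrite -[X in X + _ = _]addrA -mulrDl.
have -> : 'X^(2 * r + 8 * r) + 'X^(2 * r + 8 * r) = 0 :> {poly 'F_2}.
  rewrite -mulr2n -mulr_natr -polyC_natr (_ : 2%:R = 0 :> 'F_2) ?mulr0 //.
  exact: val_inj.
by rewrite mul0r addr0; congr ('X^ _ * _ + 'X^ _ * _); lia.
Qed.

(* The exponents 8R and 2R of the recurrence, with R = 2^q, add 2^(q+2) and 2^q
   to (exponent - 1) / 2. *)
Lemma leads_with_step q m (P Q : {poly 'F_2}) : odd m -> (m < 8 * 2 ^ q)%N ->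
  leads_with m P -> leads_with (m + 2 * 2 ^ q) Q ->
  leads_with (m + 8 * 2 ^ q) ('X^(8 * 2 ^ q) * P + 'X^(2 * 2 ^ q) * Q).
Proof.
move=> om hm /leads_withP hP /leads_withP hQ; apply/leads_withP => i.
pose M := m./2.
have eR : (2 ^ q.+2 = 4 * 2 ^ q)%N by rewrite !expnS; lia.
have em : (m = 2 * M + 1)%N by rewrite /M; lia.
have en : (m + 8 * 2 ^ q = 2 * (M + 2 ^ q.+2) + 1)%N by lia.
have em2 : (m + 2 * 2 ^ q = 2 * (M + 2 ^ q) + 1)%N by lia.
have [nca ncb] := @bits_add_pow2_nocarry q.+2 M ltac:(lia).
have [qa qb] := bits_quadruple (2 ^ q).
have -> : 'X^(8 * 2 ^ q) * P + 'X^(2 * 2 ^ q) * Q - 'X^(m + 8 * 2 ^ q)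
    = 'X^(8 * 2 ^ q) * (P - 'X^m) + 'X^(2 * 2 ^ q) * Q.
  by rewrite mulrBr -exprD [(8 * _ + m)%N]addnC addrAC.
rewrite coefD !coefXnM.
have [h1|h1] := eqVneq (if (i < 8 * 2 ^ q)%N then 0 else (P - 'X^m)`_(i - 8 * 2 ^ q)) 0;
  last first.
  (* Non-leading terms of [P]: adding 4R may carry for [k] but not for [M], so the order is kept. *)
  move=> _; case: ltnP h1 => [|hi /hP pr]; first by rewrite eqxx.
  have oi := precedes_odd pr.
  pose k := (i - 8 * 2 ^ q)./2.
  have ek : (i - 8 * 2 ^ q = 2 * k + 1)%N by rewrite /k; lia.
  have ei : (i = 2 * (k + 2 ^ q.+2) + 1)%N by lia.
  move: pr; rewrite en ek ei em => /precedesP lt; apply/precedesP.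
  have := @bits_add_pow2 q.+2 k; move: lt; rewrite /lex_lt /=; lia.
rewrite h1 add0r; case: ltnP => [|hi]; first by rewrite eqxx.
move=> nz.
(* The leading term of [Q] lands on [m] + 4R, bounded by the pair of [M] plus that of 2R, which lies
   before twice the pair of R. Any other term is bounded through the pairs of [k] and R. *)
have [e|ne] := eqVneq (i - 2 * 2 ^ q)%N (m + 2 * 2 ^ q)%N.
  have ei : (i = 2 * (M + 2 ^ q.+1) + 1)%N by rewrite expnS; lia.
  rewrite en ei; apply/precedesP.
  have := @bits_add_pow2 q.+1 M; have := bits_pow2S_lt q.
  by rewrite /lex_lt /=; rewrite eR in nca ncb *; lia.
have pr : precedes 'X^(i - 2 * 2 ^ q) 'X^(m + 2 * 2 ^ q).
  by apply: hQ; rewrite coefB coefXn (negPf ne) subr0.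
have oi := precedes_odd pr.
pose k := (i - 2 * 2 ^ q)./2.
have ek : (i - 2 * 2 ^ q = 2 * k + 1)%N by rewrite /k; lia.
have ei : (i = 2 * (k + 2 ^ q) + 1)%N by lia.
move: pr; rewrite en ek ei em2 => /precedesP lt; apply/precedesP.
have := @bits_add_pow2 q k; have := @bits_add_pow2 q M; move: lt.
by rewrite /lex_lt /=; rewrite eR in nca ncb *; lia.
Qed.

Theorem theorem3p3 (r : nat) (hr : exists e : nat, r = (2 ^ e)%N)
  (A : nat -> {poly 'F_2})
  (hA : forall n : nat, odd n -> in_tZ2t2 (A n))
  (hrec : forall n : nat, odd n ->
     A (n + 8 * r)%N = 'X^(8 * r) * A n + 'X^(2 * r) * A (n + 2 * r)%N)
  (hinit : forall n : nat, odd n -> (n < 8 * r ^ 2)%N -> leads_with n (A n)) :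
  forall n : nat, odd n -> leads_with n (A n).
Proof.
case: hr => e er; subst r.
have hrecq q : (e <= q)%N -> forall n, odd n -> A (n + 8 * 2 ^ q)%N =
    'X^(8 * 2 ^ q) * A n + 'X^(2 * 2 ^ q) * A (n + 2 * 2 ^ q)%N.
  move=> /subnKC <-; elim: (q - e)%N => [|d IH]; first by rewrite addn0.
  by rewrite addnS expnS; apply: recurrence_double.
elim/ltn_ind=> n IH on.
have [small|large] := ltnP n (8 * 2 ^ e)%N.
  apply: hinit => //; apply: leq_trans small _.
  by rewrite leq_pmul2l // -mulnn leq_pmulr // expn_gt0.
have pe : (0 < 2 ^ e)%N by rewrite expn_gt0.
pose p := trunc_log 2 n./2.
have /andP[lo hi] : (2 ^ p <= n./2 < 2 ^ p.+1)%N by apply: trunc_log_bounds; lia.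
have ep : (e.+2 <= p)%N by apply: trunc_log_max => //; rewrite !expnS; lia.
pose q := (p - 2)%N; have eq : (e <= q)%N by rewrite /q; lia.
have pq : p = q.+2 by rewrite /q; lia.
rewrite pq !expnS in lo hi.
have pp : (0 < 2 ^ q)%N by rewrite expn_gt0.
(* From 4R <= [n./2] < 8R, the index m = n - 8R is below 8R, and both m and m + 2R are below n. *)
have -> : (n = (n - 8 * 2 ^ q) + 8 * 2 ^ q)%N by lia.
rewrite hrecq //; last by lia.
by apply: leads_with_step; [lia | lia | apply: IH; lia | apply: IH; lia].
Qed.
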